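(* Let $>$ be a precedence on $\mathcal{F}$ and let $(w,w_0)$ be a weight function that is admissible for $>$. If every AC symbol $f\in\mathcal{F}_{\mathsf{AC}}$ is minimal with respect to $>$ (there is no $g\in\mathcal{F}$ with $f>g$), then the orders induced by $>$ and $(w,w_0)$ satisfy ${>_{\mathsf{S}}}={>_{\mathsf{ACKBO}}}$.
   Context: Basics. $\mathcal{F}$ is a finite signature with a designated subset $\mathcal{F}_{\mathsf{AC}}$ of binary symbols (AC symbols), $\mathcal{V}$ is a set of variables, $\mathcal{T}(\mathcal{F},\mathcal{V})$ the set of terms. $=_{\mathsf{AC}}$ is the congruence on terms induced by the equations $f(x,y)\approx f(y,x)$ and $f(f(x,y),z)\approx f(x,f(y,z))$ for all $f\in\mathcal{F}_{\mathsf{AC}}$. $|t|_x$ is the number of occurrences of $x$ in $t$; $\mathsf{root}(t)$ is the top symbol of $t$. A strict order is an irreflexive transitive relation. Precedence and weights. A precedence is a strict order $>$ on $\mathcal{F}$ (not necessarily total). A weight function $(w,w_0)$ is a map $w:\mathcal{F}\to\mathbb{N}$ and a constant $w_0>0$ with $w(c)\ge w_0$ for every constant $c$; $w(x)=w_0$ for variables and $w(f(t_1,\dots,t_n))=w(f)+\sum_i w(t_i)$. It is admissible for $>$ if every unary $f$ with $w(f)=0$ satisfies $f>g$ for all $g\in\mathcal{F}$, $g\ne f$. Top-flattening. For $f\in\mathcal{F}_{\mathsf{AC}}$, $\nabla_f(t)$ is the multiset with $\nabla_f(t)=\{t\}$ if $\mathsf{root}(t)\ne f$ and $\nabla_f(f(t_1,t_2))=\nabla_f(t_1)\uplus\nabla_f(t_2)$.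 Extensions. For relations $\succsim$ and $\succ$: $\vec x\sqsupset^{\mathsf{lex}}_k\vec y$ (tuples of length $n$) means $x_i\succsim y_i$ for all $i\le k$, and either $k=n$, or $k<n$ and $x_{k+1}\succ y_{k+1}$; $\vec x\succ^{\mathsf{lex}}\vec y$ if $\vec x\sqsupset^{\mathsf{lex}}_k\vec y$ for some $0\le k<n$. For finite multisets, $M\sqsupset^{\mathsf{mul}}_kN$ means $M,N$ can be enumerated as $x_1,\dots,x_m$ and $y_1,\dots,y_n$ with $x_j\succsim y_j$ for all $j\le k$ and, for every $k<j\le n$, some $k<i\le m$ with $x_i\succ y_j$; $M\succsim^{\mathsf{mul}}N$ if this holds for some $0\le k\le\min(m,n)$, and $M\succ^{\mathsf{mul}}N$ if it holds for some $0\le k\le\min(m-1,n)$. These depend on both $\succsim$ and $\succ$. Submultisets. For a multiset $T$ of terms: $T{\restriction}_{\mathcal{V}}$ is the submultiset of variables in $T$; $T{\restriction}^{\nless}_f$ (resp. $T{\restriction}^{<}_f$) is the submultiset of non-variable $t\in T$ with $\mathsf{root}(t)\nless f$ (resp. $\mathsf{root}(t)<f$). For a relation $R$ on terms, $S\mathrel{R^f}T$ means $S{\restriction}^{\nless}_f\ R^{\mathsf{mul}}\ \bigl(T{\restriction}^{\nless}_f\uplus(T{\restriction}_{\mathcal{V}}-S{\restriction}_{\mathcal{V}})\bigr)$. The order $>_{\mathsf{S}}$ (Steinbach), defined inductively: $s>_{\mathsf{S}}t$ if $|s|_x\ge|t|_x$ for all $x\in\mathcal{V}$ and either $w(s)>w(t)$,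 or $w(s)=w(t)$ and one of the following holds: (0) $s=f^k(t)$ with $f$ unary, $t\in\mathcal{V}$, $k>0$; (1) $s=f(s_1,\dots,s_n)$, $t=g(t_1,\dots,t_m)$, and $f>g$; (2) $s=f(s_1,\dots,s_n)$, $t=f(t_1,\dots,t_n)$, $f\notin\mathcal{F}_{\mathsf{AC}}$, $(s_1,\dots,s_n)>^{\mathsf{lex}}_{\mathsf{S}}(t_1,\dots,t_n)$; (3) $s=f(s_1,s_2)$, $t=f(t_1,t_2)$, $f\in\mathcal{F}_{\mathsf{AC}}$, and $\nabla_f(s)>^{\mathsf{mul}}_{\mathsf{S}}\nabla_f(t)$. The order $>_{\mathsf{ACKBO}}$ is defined inductively in the same way (with $>_{\mathsf{ACKBO}}$ in place of $>_{\mathsf{S}}$ in case (2)), except that case (3) is replaced by: (3) $s=f(s_1,s_2)$, $t=f(t_1,t_2)$, $f\in\mathcal{F}_{\mathsf{AC}}$, and for $S=\nabla_f(s)$, $T=\nabla_f(t)$: (a) $S>^f_{\mathsf{ACKBO}}T$; or (b) $S=^f_{\mathsf{AC}}T$ and $|S|>|T|$; or (c) $S=^f_{\mathsf{AC}}T$, $|S|=|T|$, and $S{\restriction}^{<}_f>^{\mathsf{mul}}_{\mathsf{ACKBO}}T{\restriction}^{<}_f$. In all lexicographic and multiset extensions ${\succsim}={=_{\mathsf{AC}}}$ and $\succ$ is the order being defined. *)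

(* Defs.v *)
From HB Require Import structures.
From mathcomp Require Import all_boot.

Set Implicit Arguments.
Unset Strict Implicit.
Unset Printing Implicit Defensive.

Record signature := Signature {
  symbol :> finType;
  arity : symbol -> nat;
  is_AC : pred symbol;
  AC_binary : forall f, is_AC f -> arity f = 2
}.

Arguments arity {s} f.
Arguments is_AC {s} f.

Section Terms.

Context {F : signature} {V : eqType}.

(* Finite functions, unlike tuples, are strictly positive in their codomain. *)
Inductive term : Type :=
| Var of V
| App (f : F) of {ffun 'I_(arity f) -> term}.

(* The automatically generated principle has no hypothesis on the arguments. *)
Lemma term_ind_args (P : term -> Prop) :
    (forall x, P (Var x)) ->
    (forall (f : F) (ts : {ffun 'I_(arity f) -> term}),
       (forall i, P (ts i)) -> P (App ts)) ->
  forall t, P t.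
Proof.
move=> PV PA; fix IH 1; case=> [x|f ts]; first exact: PV.
by apply: PA => i; apply: IH.
Defined.

Fixpoint encode_term (t : term) : GenTree.tree (V + F) :=
  match t with
  | Var x => GenTree.Leaf (inl x)
  | App f ts => GenTree.Node 0 (GenTree.Leaf (inr f)
                  :: [seq encode_term (ts i) | i <- enum 'I_(arity f)])
  end.

Lemma encode_term_inj : injective encode_term.
Proof.
elim/term_ind_args=> [x|f ts IH] [y|g us] //=; first by case=> ->.
case=> efg; case: g / efg us => us /eq_in_map eq_us.
by congr App; apply/ffunP=> i; apply/IH/eq_us; rewrite mem_enum.
Qed.

HB.instance Definition _ := Equality.copy term (inj_type encode_term_inj).

Definition App1 (f : F) (t : term) : term := App [ffun _ : 'I_(arity f) => t].

Definition App2 (f : F) (s t : term) : term :=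
  App [ffun i : 'I_(arity f) => if i == 0 :> nat then s else t].

Inductive eqAC : term -> term -> Prop :=
| eqAC_comm (f : F) s t :
    is_AC f -> eqAC (App2 f s t) (App2 f t s)
| eqAC_assoc (f : F) s t u :
    is_AC f -> eqAC (App2 f (App2 f s t) u) (App2 f s (App2 f t u))
| eqAC_refl t : eqAC t t
| eqAC_sym s t : eqAC s t -> eqAC t s
| eqAC_trans s t u : eqAC s t -> eqAC t u -> eqAC s u
| eqAC_congr (f : F) (ss ts : {ffun 'I_(arity f) -> term}) :
    (forall i, eqAC (ss i) (ts i)) -> eqAC (App ss) (App ts).

Fixpoint occ (x : V) (t : term) : nat :=
  match t with
  | Var y => x == y
  | App f ts => \sum_(i < arity f) occ x (ts i)
  end.

Definition is_var (t : term) : bool := if t is Var _ then true else false.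

(* Finite multisets are represented by sequences; every notion below depends on
   them only up to permutation. *)
Fixpoint flat (f : F) (t : term) : seq term :=
  match t with
  | Var _ => [:: t]
  | App g ts =>
      if g == f then flatten [seq flat f (ts i) | i <- enum 'I_(arity g)]
      else [:: t]
  end.

End Terms.

Arguments term : clear implicits.

Section Extensions.

Variable T : eqType.
Variables ge gt : T -> T -> Prop.

Definition lex_at (n k : nat) (x y : {ffun 'I_n -> T}) : Prop :=
  (forall i : 'I_n, i < k -> ge (x i) (y i)) /\
  (k = n \/ exists2 i : 'I_n, i = k :> nat & gt (x i) (y i)).

Definition lex_gt (n : nat) (x y : {ffun 'I_n -> T}) : Prop :=
  exists2 k, k < n & lex_at k x y.

Definition mul_at (k : nat) (M N : seq T) : Prop :=
  exists (x : (size M).-tuple T) (y : (size N).-tuple T),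
  [/\ perm_eq x M, perm_eq y N,
      forall (i : 'I_(size M)) (j : 'I_(size N)),
        i = j :> nat -> j < k -> ge (tnth x i) (tnth y j)
    & forall j : 'I_(size N), k <= j ->
        exists2 i : 'I_(size M), k <= i & gt (tnth x i) (tnth y j)].

Definition mul_ge (M N : seq T) : Prop :=
  exists2 k, k <= minn (size M) (size N) & mul_at k M N.

(* [k < size M] is k <= |M| - 1 without truncated subtraction: it excludes an
   empty M. *)
Definition mul_gt (M N : seq T) : Prop :=
  exists2 k, (k < size M) && (k <= size N) & mul_at k M N.

End Extensions.

Definition mset_diff (T : eqType) (M N : seq T) : seq T :=
  foldr (fun x M' => rem x M') M N.

Section Orders.

Context {F : signature} {V : eqType}.
Local Notation term := (term F V).

(* [prec f g] means f > g. *)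
Definition precedence (prec : rel F) : Prop :=
  irreflexive prec /\ transitive prec.

Definition weight_function (w : F -> nat) (w0 : nat) : Prop :=
  0 < w0 /\ forall c : F, arity c = 0 -> w0 <= w c.

Definition admissible (prec : rel F) (w : F -> nat) : Prop :=
  forall f : F, arity f = 1 -> w f = 0 -> forall g : F, g != f -> prec f g.

Fixpoint weight (w : F -> nat) (w0 : nat) (t : term) : nat :=
  match t with
  | Var _ => w0
  | App f ts => w f + \sum_(i < arity f) weight w w0 (ts i)
  end.

Variables (prec : rel F) (w : F -> nat) (w0 : nat).

Definition restr_var (T : seq term) : seq term := [seq t <- T | is_var t].

Definition restr_nlt (f : F) (T : seq term) : seq term :=
  [seq t <- T | if t is App g _ then ~~ prec f g else false].

Definition restr_lt (f : F) (T : seq term) : seq term :=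
  [seq t <- T | if t is App g _ then prec f g else false].

(* [Rmul] is the multiset extension R^mul of the relation R in S R^f T. *)
Definition ext_f (Rmul : seq term -> seq term -> Prop) (f : F)
    (S T : seq term) : Prop :=
  Rmul (restr_nlt f S)
       (restr_nlt f T ++ mset_diff (restr_var T) (restr_var S)).

Definition case_unary (s t : term) : Prop :=
  exists (f : F) (k : nat) (x : V),
    [/\ arity f = 1, 0 < k, s = iter k (App1 f) t & t = Var x].

Definition case_prec (s t : term) : Prop :=
  exists (f : F) (ss : {ffun 'I_(arity f) -> term})
         (g : F) (ts : {ffun 'I_(arity g) -> term}),
    [/\ s = App ss, t = App ts & prec f g].

Definition case_lex (gt : term -> term -> Prop) (s t : term) : Prop :=
  exists (f : F) (ss ts : {ffun 'I_(arity f) -> term}),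
    [/\ s = App ss, t = App ts, ~~ is_AC f & lex_gt eqAC gt ss ts].

Definition case_AC (cmp : F -> seq term -> seq term -> Prop)
    (s t : term) : Prop :=
  exists (f : F) (ss ts : {ffun 'I_(arity f) -> term}),
    [/\ s = App ss, t = App ts, is_AC f & cmp f (flat f s) (flat f t)].

(* The common shape of the two orders, which differ in the comparison [cmp] of
   the flattened arguments of an AC symbol. *)
Definition kbo_step (gt : term -> term -> Prop)
    (cmp : F -> seq term -> seq term -> Prop) (s t : term) : Prop :=
  (forall x : V, occ x t <= occ x s) /\
  (weight w w0 t < weight w w0 s \/
   weight w w0 s = weight w w0 t /\
   [\/ case_unary s t, case_prec s t, case_lex gt s t | case_AC cmp s t]).

Definition cmp_S (gt : term -> term -> Prop) (f : F) (S T : seq term) : Prop :=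
  mul_gt eqAC gt S T.

(* S =_AC^f T uses the non-strict multiset extension for the pair (=_AC, gt).
   That extension is the union of the strict one and of equality of multisets
   modulo AC, and the strict one is already covered by the first disjunct, so
   reading it as equality of multisets modulo AC gives the same comparison. *)
Definition cmp_ACKBO (gt : term -> term -> Prop) (f : F) (S T : seq term) :
    Prop :=
  [\/ ext_f (mul_gt eqAC gt) f S T,
      ext_f (mul_ge eqAC gt) f S T /\ size T < size S
    | [/\ ext_f (mul_ge eqAC gt) f S T, size S = size T
        & mul_gt eqAC gt (restr_lt f S) (restr_lt f T)]].

Inductive gt_S : term -> term -> Prop :=
| Gt_S s t : kbo_step gt_S (cmp_S gt_S) s t -> gt_S s t.

Inductive gt_ACKBO : term -> term -> Prop :=
| Gt_ACKBO s t : kbo_step gt_ACKBO (cmp_ACKBO gt_ACKBO) s t -> gt_ACKBO s t.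

End Orders.

(* Main.v *)
Require Import Defs.
From mathcomp Require Import all_boot.

(** A minimal AC symbol [f] has no symbol below it, so [S] restricted to roots
    below [f] is empty and case (c) of ACKBO never applies, while [S] restricted
    to roots not below [f] consists of all non-variable members of [S]. A
    variable is AC-equal only to itself and is greater than no term. Hence, in a
    multiset comparison of [S] and [T], the variables common to both may be
    matched with each other and cancelled, and the remaining variables of [S]
    dominate nothing; they count only through the cardinalities, which is what
    case (b) records. So the two comparisons of flattened arguments agree over a
    fixed order, and since a step on [s] consults the order only on proper
    subterms of [s], the two orders agree by induction on [s]. *)

Set Implicit Arguments.
Unset Strict Implicit.
Unset Printing Implicit Defensive.

(** * Multiset extensions as decompositions *)

Section MultisetExtension.

Variable T : eqType.
Variables ge gt : T -> T -> Prop.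

(** Index-free form of [mul_at]: working up to permutation lets filtering and concatenation act
    directly on the matched pairs [P] and on the rests [M'], [N']. *)
Definition mul_decomp (M N : seq T) (P : seq (T * T)) (M' N' : seq T) : Prop :=
  [/\ perm_eq M (unzip1 P ++ M'), perm_eq N (unzip2 P ++ N'),
      {in P, forall p, ge p.1 p.2}
    & {in N', forall y, exists2 x, x \in M' & gt x y}].

Lemma mul_at_decomp k M N : k <= size M -> k <= size N -> mul_at ge gt k M N ->
  exists P M' N', size P = k /\ mul_decomp M N P M' N'.
Proof.
move=> kM kN [x [y [xM yN xy_ge xy_gt]]].
have size_xk : size (take k x) = k by rewrite size_takel ?size_tuple.
have size_yk : size (take k y) = k by rewrite size_takel ?size_tuple.
exists (zip (take k x) (take k y)), (drop k x), (drop k y).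
split; first by rewrite size_zip size_xk size_yk minnn.
have eq_size : size (take k x) = size (take k y) by rewrite size_xk.
split.
- by rewrite unzip1_zip ?eq_size// cat_take_drop perm_sym.
- by rewrite unzip2_zip ?eq_size// cat_take_drop perm_sym.
- move=> p /(nthP p) [j]; rewrite size_zip size_xk size_yk minnn => jk <-.
  case: p => a b; rewrite nth_zip//= !nth_take//.
  have := xy_ge (Ordinal (leq_trans jk kM)) (Ordinal (leq_trans jk kN)) erefl jk.
  by rewrite (tnth_nth a) (tnth_nth b).
- move=> b /(nthP b) [j]; rewrite size_drop size_tuple ltn_subRL => jN <-.
  rewrite nth_drop.
  have [i ki] := xy_gt (Ordinal jN) (leq_addr _ _).
  rewrite [tnth y _](tnth_nth b) /= => gt_ij.
  exists (tnth x i) => //; rewrite (tnth_nth b) -(subnKC ki) -nth_drop.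
  by rewrite mem_nth// size_drop size_tuple ltn_sub2r// (leq_ltn_trans ki).
Qed.

Lemma decomp_mul_at M N P M' N' :
  mul_decomp M N P M' N' -> mul_at ge gt (size P) M N.
Proof.
move=> [MP NP P_ge N'_gt].
have szM : size (unzip1 P ++ M') == size M by rewrite (perm_size MP).
have szN : size (unzip2 P ++ N') == size N by rewrite (perm_size NP).
exists (Tuple szM), (Tuple szN); split.
- by rewrite perm_sym.
- by rewrite perm_sym.
- move=> i j eq_ij ltjP.
  (* [a] and [b] serve only as default values for [nth]. *)
  have a := tnth (Tuple szM) i; have b := tnth (Tuple szN) j.
  rewrite (tnth_nth a) (tnth_nth b) /= eq_ij !nth_cat !size_map ltjP.
  by rewrite !(nth_map (a, b))//; apply/P_ge/mem_nth.
- move=> j lePj; have b := tnth (Tuple szN) j.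
  have ltjN' : j - size P < size N'.
    have := ltn_ord j; rewrite -{2}(eqP szN) size_cat size_map.
    by rewrite ltn_subLR.
  have [a aM' gt_a] := N'_gt _ (mem_nth b ltjN').
  have lt_a : size P + index a M' < size M.
    by rewrite -(eqP szM) size_cat size_map ltn_add2l index_mem.
  exists (Ordinal lt_a); first exact: leq_addr.
  rewrite (tnth_nth b) (tnth_nth b) /= !nth_cat !size_map.
  by rewrite [j < _]ltnNge lePj ltnNge leq_addr /= addKn nth_index.
Qed.

Lemma mul_geP M N :
  mul_ge ge gt M N <-> exists P M' N', mul_decomp M N P M' N'.
Proof.
split=> [[k] | [P [M' [N' dec]]]].
  rewrite leq_min => /andP[kM kN] /(mul_at_decomp kM kN)[P [M' [N' [_ dec]]]].
  by exists P, M', N'.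
have [MP NP _ _] := dec; exists (size P); last exact: decomp_mul_at dec.
by rewrite leq_min (perm_size MP) (perm_size NP) !size_cat !size_map !leq_addr.
Qed.

Lemma mul_gtP M N :
  mul_gt ge gt M N <-> exists P M' N', mul_decomp M N P M' N' /\ 0 < size M'.
Proof.
split=> [[k] | [P [M' [N' [dec M'_gt0]]]]].
  move=> /andP[kM kN] /(mul_at_decomp (ltnW kM) kN)[P [M' [N' [szP dec]]]].
  exists P, M', N'; split=> //; have [MP _ _ _] := dec.
  by move: kM; rewrite (perm_size MP) size_cat size_map szP -ltn_subLR// subnn.
have [MP NP _ _] := dec; exists (size P); last exact: decomp_mul_at dec.
rewrite (perm_size MP) (perm_size NP) !size_cat !size_map leq_addr andbT.
by rewrite -[ltnLHS]addn0 ltn_add2l.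
Qed.

End MultisetExtension.

(** Only members of [M] occur to the left of [gt], so an induction hypothesis about the members of a
    flattening suffices to change the order. *)
Lemma mul_gt_sub (T : eqType) (ge gt gt' : T -> T -> Prop) (M N : seq T) :
    (forall x y, x \in M -> gt x y -> gt' x y) ->
  mul_gt ge gt M N -> mul_gt ge gt' M N.
Proof.
move=> sub_gt [k kMN [x [y [xM yN xy_ge xy_gt]]]].
exists k => //; exists x, y; split=> // j kj.
have [i ki gt_ij] := xy_gt j kj; exists i => //.
by apply: sub_gt gt_ij; rewrite -(perm_mem xM) mem_tnth.
Qed.

(** [C] collects the elements of [N] that cancel against [M], and [E] those that find no partner. *)
Lemma mset_diff_split (T : eqType) (M N : seq T) :
  exists C E, perm_eq M (mset_diff M N ++ C) /\ perm_eq N (C ++ E).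
Proof.
elim: N => [|x N [C [E [MC NC]]]] /=; first by exists [::], [::]; rewrite cats0.
have [xD | xND] := boolP (x \in mset_diff M N).
  exists (x :: C), E; split; last by rewrite /= perm_cons.
  apply: perm_trans MC _; rewrite perm_sym -cat1s perm_catCA perm_sym catA perm_cat2r.
  exact: perm_to_rem.
exists C, (x :: E); rewrite rem_id//; split=> //.
by rewrite perm_sym -cat1s perm_catCA perm_cons perm_sym.
Qed.

Lemma mset_diff_count (T : eqType) (M N : seq T) (x : T) :
  count_mem x (mset_diff M N) = count_mem x M - count_mem x N.
Proof.
elim: N => [|y N IH] /=; first by rewrite subn0.
rewrite count_rem /= [(y == x) + _]addnC subnDA -IH.
have [->|_] := eqVneq y x; last by rewrite andbF.
by rewrite andbT -has_pred1 has_count; case: count.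
Qed.

(** * Terms, variables and a single step of the orders *)

Section Terms.

Context {F : signature} {V : eqType}.
Local Notation term := (term F V).

(* Sound because [flat f (App ts)] contains only proper subterms when [f] is the
   root of [App ts]. *)
Lemma term_ind_flat (P : term -> Prop) :
    (forall s : term,
       (forall f (ts : {ffun 'I_(arity f) -> term}), s = App ts ->
         (forall i, P (ts i)) /\ {in flat f s, forall u, P u}) ->
       P s) ->
  forall t, P t.
Proof.
move=> PI t.
(* An argument with the same root is flattened further, so the claim must also cover the flattenings
   of arguments. *)
suff [] : P t /\ forall f, {in flat f t, forall u, P u} by [].
elim/(@term_ind_args F V): t => [x|g ts IH].
  have Px : P (Var x) by apply: PI.
  by split=> // f u; rewrite inE => /eqP ->.
have Pt : P (App ts).
  apply: PI => f us e.
  (* Transporting [Q] along [e] avoids inverting an equation between dependent applications. *)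
  pose Q s := if s is App h vs then
      (forall i, P (vs i)) /\ {in flat h s, forall u, P u} else True.
  suff: Q (App ts) by rewrite e.
  split=> [i | u]; first by have [] := IH i.
  rewrite /= eqxx => /flattenP[l /mapP[i _ ->]].
  by have [_] := IH i; apply.
split=> // f u /=; case: ifP => _; last by rewrite inE => /eqP ->.
by move=> /flattenP[l /mapP[i _ ->]]; have [_] := IH i; apply.
Qed.

Lemma eqAC_var (s t : term) :
  eqAC s t -> is_var s = is_var t /\ (is_var s -> s = t).
Proof.
elim=> // {s t} [s t _ [-> eq_st] | s t u _ [-> eq_st] _ [-> eq_tu]].
  by split=> // /eq_st.
by split=> // vu; rewrite eq_st ?eq_tu.
Qed.

Variables (prec : rel F) (w : F -> nat) (w0 : nat).

Lemma weight_ge (t : term) : weight_function w w0 -> w0 <= weight w w0 t.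
Proof.
move=> [_ w_const]; elim/(@term_ind_args F V): t => [x|f ts IH] //=.
have [/w_const le_w | f_gt0] := posnP (arity f).
  exact: leq_trans (leq_addr _ _).
rewrite (bigD1 (Ordinal f_gt0)) //= addnCA.
exact: leq_trans (IH _) (leq_addr _ _).
Qed.

(** A variable has the least possible weight, and each case of equal weight has an application on
    the left. *)
Lemma kbo_step_nonvar gt cmp (s t : term) :
  weight_function w w0 -> kbo_step prec w w0 gt cmp s t -> ~~ is_var s.
Proof.
move=> w_wf [_ [lt_w | [_ []]]].
- by case: s lt_w => //= x; rewrite ltnNge weight_ge.
- by move=> [f [[|k] [x []]]] // _ _ ->.
- by move=> [f [ss [g [ts [-> _ _]]]]].
- by move=> [f [ss [ts [-> _ _ _]]]].
- by move=> [f [ss [ts [-> _ _ _]]]].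
Qed.

Lemma kbo_step_sub gt gt' cmp cmp' (s t : term) :
    (forall f (ss : {ffun 'I_(arity f) -> term}), s = App ss ->
      (forall i u, gt (ss i) u -> gt' (ss i) u) /\
      (is_AC f -> cmp f (flat f s) (flat f t) ->
        cmp' f (flat f s) (flat f t))) ->
  kbo_step prec w w0 gt cmp s t -> kbo_step prec w w0 gt' cmp' s t.
Proof.
move=> sub [le_occ [lt_w | [eq_w cases]]]; split=> //; first by left.
right; split=> //; case: cases.
- by constructor 1.
- by constructor 2.
- move=> [f [ss [ts [s_def t_def fNAC [k kf [ss_eq ss_gt]]]]]]; constructor 3.
  have [sub_gt _] := sub f ss s_def.
  exists f, ss, ts; split=> //; exists k => //; split=> //.
  case: ss_gt => [|[i ik /sub_gt gt'_i]]; first by left.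
  by right; exists i.
- move=> [f [ss [ts [s_def t_def fAC]]]] cmp_st; constructor 4.
  have [_ sub_cmp] := sub f ss s_def.
  by exists f, ss, ts; split=> //; apply: sub_cmp.
Qed.

Lemma cmp_S_ACKBO (gt : term -> term -> Prop) (f : F) (S T : seq term) :
    (forall g, ~~ prec f g) -> (forall s t, gt s t -> ~~ is_var s) ->
  cmp_S gt f S T <-> cmp_ACKBO prec gt f S T.
Proof.
move=> f_min gt_nonvar.
have nlt X : restr_nlt prec f X = [seq t : term <- X | ~~ is_var t].
  by apply: eq_filter => -[x|g ts] /=; rewrite ?f_min.
have perm_var (X : seq term) : perm_eq (restr_var X ++ restr_nlt prec f X) X.
  by rewrite nlt perm_filterC.
rewrite /cmp_S /cmp_ACKBO /ext_f; set D := mset_diff _ _; split.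
  move=> /mul_gtP[P [M [N [[SP TP P_eq N_gt] M_gt0]]]].
  pose P' := [seq p : term * term <- P | ~~ is_var p.1].
  (* Matched variables are equal, so they contribute equally to both sides; a variable in excess in
     [T] must therefore occur in the dominated rest [N]. *)
  have D_sub : {subset D <= N}.
    move=> x; rewrite -has_pred1 has_count mset_diff_count subn_gt0.
    pose var_x := [pred t : term | (t == x) && is_var t].
    have cnt (X : seq term) : count_mem x (restr_var X) = count var_x X.
      by rewrite count_filter.
    rewrite !cnt (permP SP) (permP TP) !count_cat.
    have -> : count var_x (unzip2 P) = count var_x (unzip1 P).
      rewrite !count_map; apply: eq_in_count => p pP /=.
      have [eq_var eq_p] := eqAC_var (P_eq p pP).
      rewrite -eq_var.
      by have [/eq_p <- //|] := boolP (is_var p.1); rewrite !andbF.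
    rewrite ltn_add2l => /(leq_ltn_trans (leq0n _)).
    by rewrite -has_count => /hasP[y yN /andP[/eqP <-]].
  have dec : mul_decomp eqAC gt (restr_nlt prec f S) (restr_nlt prec f T ++ D)
      P' [seq t <- M | ~~ is_var t] ([seq t <- N | ~~ is_var t] ++ D).
    split.
    - rewrite nlt (perm_trans (perm_filter _ SP))// filter_cat perm_cat2r.
      by rewrite filter_map.
    - rewrite nlt catA perm_cat2r (perm_trans (perm_filter _ TP))//.
      have -> : P' = [seq p <- P | ~~ is_var p.2].
        by apply: eq_in_filter => p /P_eq/eqAC_var[->].
      by rewrite filter_cat perm_cat2r filter_map.
    - by move=> p; rewrite mem_filter => /andP[_ /P_eq].
    - move=> y; rewrite mem_cat mem_filter => y_in.
      (* The dominating [x] is not a variable, so it survives the filter on [M]. *)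
      have /N_gt[x xM gt_xy] : y \in N by case/orP: y_in => [/andP[]|/D_sub].
      by exists x => //; rewrite mem_filter xM (gt_nonvar x y).
  (* If [M] consists of variables it dominates nothing, so [N] is empty and [S] is larger than [T]:
     case (b). Otherwise case (a) holds. *)
  have [M_nil | M'_gt0] := posnP (size [seq t <- M | ~~ is_var t]).
    constructor 2; split; first by apply/mul_geP; do 3!eexists; exact: dec.
    rewrite (perm_size SP) (perm_size TP) !size_cat !size_map ltn_add2l.
    case: N N_gt {TP D_sub dec} => // y N N_gt.
    have [x xM /gt_nonvar x_nonvar] := N_gt y (mem_head _ _).
    have : x \in [seq t <- M | ~~ is_var t] by rewrite mem_filter x_nonvar.
    by rewrite (size0nil M_nil).
  by constructor 1; apply/mul_gtP; do 3!eexists; split; first exact: dec.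
have [C [E [TC SC]]] := mset_diff_split (restr_var T) (restr_var S).
(* The common variables [C] are matched with themselves; the surplus variables [E] of [S] join the
   unmatched left part. *)
have lift P M N :
    mul_decomp eqAC gt (restr_nlt prec f S) (restr_nlt prec f T ++ D) P M N ->
  mul_decomp eqAC gt S T ([seq (c, c) | c <- C] ++ P) (E ++ M) N.
  move=> [SP TP P_eq N_gt].
  have unzip_C1 : unzip1 [seq (c, c) | c <- C] = C.
    by rewrite /unzip1 -map_comp map_id.
  have unzip_C2 : unzip2 [seq (c, c) | c <- C] = C.
    by rewrite /unzip2 -map_comp map_id.
  split=> //.
  - apply/permP=> a; rewrite -(permP (perm_var S)) /unzip1 map_cat -/unzip1.
    by rewrite unzip_C1 !count_cat (permP SC) (permP SP) !count_cat addnACA.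
  - apply/permP=> a; rewrite -(permP (perm_var T)) /unzip2 map_cat -/unzip2.
    have := permP TP a; rewrite unzip_C2 !count_cat (permP TC) count_cat -/D.
    by rewrite [count a D + _]addnC -!addnA [count a D + _]addnC => ->.
  - move=> p; rewrite mem_cat => /orP[/mapP[c _ ->] /= | /P_eq//].
    exact: eqAC_refl.
  - move=> y /N_gt[x xM gt_xy]; exists x => //.
    by rewrite mem_cat xM orbT.
case.
- move=> /mul_gtP[P [M [N [/lift dec M_gt0]]]].
  apply/mul_gtP; do 3!eexists; split; first exact: dec.
  by rewrite size_cat addn_gt0 M_gt0 orbT.
- move=> [/mul_geP[P [M [N /lift dec]]] ltTS].
  apply/mul_gtP; do 3!eexists; split; first exact: dec.
  (* The matched parts have equal size, so the size gap makes the unmatched left part nonempty. *)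
  have [SP TP _ _] := dec; move: ltTS.
  rewrite (perm_size SP) (perm_size TP) !size_cat !size_map ltn_add2l.
  exact: leq_ltn_trans.
- move=> [_ _]; suff lt_nil (X : seq term) : restr_lt prec f X = [::].
    by rewrite !lt_nil; case.
  rewrite -(filter_pred0 X); apply: eq_filter => -[x|g ts] //=.
  exact: negPf.
Qed.

End Terms.

Theorem theorem5p2 (F : signature) (V : eqType) (prec : rel F)
    (w : F -> nat) (w0 : nat)
    (prec_order : precedence prec)
    (w_weight : weight_function w w0)
    (w_admissible : admissible prec w)
    (AC_minimal : forall f : F, is_AC f -> ~ exists g : F, prec f g) :
  forall s t : term F V, gt_S prec w w0 s t <-> gt_ACKBO prec w w0 s t.
Proof.
have gt_ACKBO_step (s t : term F V) : gt_ACKBO prec w w0 s t ->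
    kbo_step prec w w0 (gt_ACKBO prec w w0)
      (cmp_ACKBO prec (gt_ACKBO prec w w0)) s t by case.
have gt_S_step (s t : term F V) : gt_S prec w w0 s t ->
    kbo_step prec w w0 (gt_S prec w w0) (cmp_S (gt_S prec w w0)) s t by case.
(* One fixed order suffices for both directions: the passage between the two orders is made inside
   [cmp_S], where [mul_gt_sub] applies. *)
have cmpP f : is_AC f -> forall S T : seq (term F V),
    cmp_S (gt_ACKBO prec w w0) f S T <->
    cmp_ACKBO prec (gt_ACKBO prec w w0) f S T.
  move=> fAC S T; apply: cmp_S_ACKBO => [g | s t /gt_ACKBO_step].
    by apply/negP=> fg; apply: (AC_minimal f fAC); exists g.
  exact: kbo_step_nonvar.
elim/(@term_ind_flat F V)=> s IH t; split.
- move=> /gt_S_step step; constructor.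
  apply: kbo_step_sub step => f ss /IH[IHss IHflat].
  split=> [i u /IHss// | fAC cmp]; apply/(cmpP f fAC).
  by apply: mul_gt_sub cmp => x y /IHflat xy /xy.
- move=> /gt_ACKBO_step step; constructor.
  apply: kbo_step_sub step => f ss /IH[IHss IHflat].
  split=> [i u /IHss// | fAC /(cmpP f fAC) cmp].
  by apply: mul_gt_sub cmp => x y /IHflat xy /xy.
Qed.
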